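(* Almost every sparse paving matroid has a minor isomorphic to $\mathcal{W}^3$ or to $M(K_4)$; that is, if $s(n)$ is the number of sparse paving matroids on ground set $[n]$ and $s_{\mathcal{X}}(n)$ is the number of those having no minor isomorphic to $\mathcal{W}^3$ or $M(K_4)$, then $s_{\mathcal{X}}(n)=o(s(n))$ as $n\to\infty$.
   Context: A matroid is sparse paving if every nonspanning circuit is also a hyperplane. $\mathcal{W}^3$ is the rank-3 whirl: the rank-3 matroid on $\{a,b,c,d,e,f\}$ whose only dependent 3-sets are $\{a,b,c\},\{c,d,e\},\{e,f,a\}$. $M(K_4)$ is the cycle matroid of $K_4$; equivalently the rank-3 matroid on $\{a,b,c,d,e,f\}$ whose only dependent 3-sets are $\{a,b,c\},\{c,d,e\},\{e,f,a\},\{b,d,f\}$. Matroids are counted as labelled matroids on $[n]$. *)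

(* Defs.v *)
(* Matroids on a finite ground set T (all of T),
   given by their family of independent sets. *)
From mathcomp Require Import all_boot all_order all_algebra.
Set Implicit Arguments. Unset Strict Implicit. Unset Printing Implicit Defensive.
Import Order.TTheory GRing.Theory Num.Theory.

Section Matroids.
Variable T : finType.
Implicit Types (I : {set {set T}}) (X Y F C D : {set T}).

Definition is_matroid I : bool :=
  [&& set0 \in I,
      [forall X : {set T}, forall Y : {set T}, (Y \in I) && (X \subset Y) ==> (X \in I)] &
      [forall X : {set T}, forall Y : {set T}, (X \in I) && (Y \in I) && (#|X| < #|Y|) ==>
          [exists x : T, (x \in Y :\: X) && ((x |: X) \in I)]]].

Definition rank I X : nat := \max_(Y in I | Y \subset X) #|Y|.

Definition circuit I C : bool :=
  (C \notin I) && [forall D : {set T}, (D \proper C) ==> (D \in I)].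

Definition flat I F : bool :=
  [forall x : T, (x \notin F) ==> (rank I F < rank I (x |: F))].
Definition hyperplane I F : bool :=
  flat I F && ((rank I F).+1 == rank I [set: T]).

Definition sparse_paving I : bool :=
  [forall C : {set T}, circuit I C && (rank I C < rank I [set: T]) ==> hyperplane I C].

(* Deletion and contraction, as families of independent sets (on T) of the
   matroids M\D and M/C, whose ground sets are T \ D, resp. T \ C. *)
Definition delete I D : {set {set T}} := [set X in I | [disjoint X & D]].
Definition contract I C : {set {set T}} :=
  [set X : {set T} | [disjoint X & C] && (rank I (X :|: C) == #|X| + rank I C)].

Definition has_minor_iso (k : nat) I (N : {set {set 'I_k}}) : bool :=
  [exists C : {set T}, exists D : {set T}, exists f : {ffun 'I_k -> T},
     [&& [disjoint C & D], injectiveb f,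
         f @: [set: 'I_k] == ~: (C :|: D) &
         [forall X : {set 'I_k}, (X \in N) == (f @: X \in delete (contract I C) D)]]].

End Matroids.

Definition rank3_on6 (dep : seq {set 'I_6}) : {set {set 'I_6}} :=
  [set X : {set 'I_6} | (#|X| <= 2) || ((#|X| == 3) && (X \notin dep))].

Definition ia : 'I_6 := inord 0. Definition ib : 'I_6 := inord 1.
Definition ic : 'I_6 := inord 2. Definition id6 : 'I_6 := inord 3.
Definition ie : 'I_6 := inord 4. Definition iF : 'I_6 := inord 5.

Definition whirl3 : {set {set 'I_6}} :=
  rank3_on6 [:: [set ia; ib; ic]; [set ic; id6; ie]; [set ie; iF; ia]].
Definition MK4 : {set {set 'I_6}} :=
  rank3_on6 [:: [set ia; ib; ic]; [set ic; id6; ie]; [set ie; iF; ia];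
                [set ib; id6; iF]].

Definition sp_count (n : nat) : nat :=
  #|[set I : {set {set 'I_n}} | is_matroid I && sparse_paving I]|.
Definition spX_count (n : nat) : nat :=
  #|[set I : {set {set 'I_n}} | [&& is_matroid I, sparse_paving I,
        ~~ has_minor_iso I whirl3 & ~~ has_minor_iso I MK4]]|.

(* Main.v *)
(** In rank [r], a sparse paving matroid is determined by its set [S] of
    dependent [r]-sets, which is a stable set of the Johnson graph J(n, r), and
    (for [0 < r < n]) every stable set arises.  If an [r]-set [u] has three
    neighbours [u - e + b], [u - a + d], [u - c + f] in [S], then stability
    forces [a, c, e] and [b, d, f] to be distinct, and contracting
    [u - {a, c, e}] and restricting to [{a, ..., f}] leaves a matroid in which
    [abc], [cde], [efa] are dependent; the only other 3-set that stability
    allows to be dependent is [bdf], so this minor is W^3 or M(K_4).  Without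
    such minors every [u] thus has at most two neighbours in [S], and double
    counting gives [|S| r (n - r) <= 2 'C(n, r)].  With [M] the largest
    ['C(n, r)] this yields [|S| = O(M / n^2)], and there are only [2^o(M / n)]
    such families [S].  On the other hand (Graham and Sloane), fixing the sum
    of the elements modulo [n] splits the [r]-sets into [n] stable classes; all
    subsets of the largest class give sparse paving matroids, so
    [s(n) >= 2^(M / n)]. *)
Require Import Defs.
From mathcomp Require Import all_boot all_order all_algebra.
From mathcomp Require Import zify.
Set Implicit Arguments. Unset Strict Implicit. Unset Printing Implicit Defensive.
Import Order.TTheory GRing.Theory Num.Theory.

(** * From sparse paving matroids to stable families of nonbases *)

Section SparsePaving.
Variable T : finType.
Implicit Types (I S : {set {set T}}) (X Y C u : {set T}).

Definition nonbases I : {set {set T}} :=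
  [set X : {set T} | (#|X| == rank I setT) && (X \notin I)].

(** On [r]-sets this says that no two are adjacent in the Johnson graph, where adjacent sets share
    [r - 1] elements; the successor on the left avoids truncated subtraction. *)
Definition stable (r : nat) S :=
  {in S &, forall X Y, X != Y -> #|X :&: Y|.+1 < r}.

Lemma rank_le_card I X : rank I X <= #|X|.
Proof. by apply/bigmax_leqP => Y /andP[_ sYX]; apply: subset_leq_card. Qed.

Lemma rankS I X Y : X \subset Y -> rank I X <= rank I Y.
Proof.
move=> sXY; apply/bigmax_leqP => Z /andP[ZI sZX].
by apply: leq_bigmax_cond; rewrite ZI (subset_trans sZX).
Qed.

Lemma card_le_rank I X : X \in I -> #|X| <= rank I setT.
Proof. by move=> XI; apply: leq_bigmax_cond; rewrite XI subsetT. Qed.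

Lemma rank_indep I X : X \in I -> rank I X = #|X|.
Proof.
move=> XI; apply/eqP; rewrite eqn_leq rank_le_card /=.
by apply: leq_bigmax_cond; rewrite XI subxx.
Qed.

Lemma rank_witness I X : set0 \in I ->
  exists Y, [/\ Y \in I, Y \subset X & #|Y| = rank I X].
Proof.
move=> I0; rewrite /rank.
have P0 : (set0 \in I) && (set0 \subset X) by rewrite I0 sub0set.
have [|Y] := @eq_bigmax_cond _ [pred Y : {set T} | (Y \in I) && (Y \subset X)] (fun Y => #|Y|).
  by apply/card_gt0P; exists set0.
by case/andP=> YI sYX ->; exists Y.
Qed.

Lemma rank_dep I X : set0 \in I -> X \notin I -> rank I X < #|X|.
Proof.
move=> I0 XnI; have [Y [YI sYX <-]] := rank_witness X I0.
apply: proper_card; rewrite properEneq sYX andbT.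
by apply: contraNneq XnI => <-.
Qed.

Lemma rank_eq_card I X : set0 \in I -> (rank I X == #|X|) = (X \in I).
Proof.
move=> I0; apply/eqP/idP => [e|]; last exact: rank_indep.
by apply: contraT => /(rank_dep I0); rewrite e ltnn.
Qed.

Lemma matroid0 I : is_matroid I -> set0 \in I.
Proof. by case/and3P. Qed.

Lemma matroid_aug I X Y : is_matroid I -> X \in I -> Y \in I -> #|X| < #|Y| ->
  exists2 x, x \in Y :\: X & x |: X \in I.
Proof.
case/and3P => _ _ /forallP/(_ X)/forallP/(_ Y)/implyP h XI YI lt.
by rewrite XI YI in h; have /existsP[x /andP[]] := h lt; exists x.
Qed.

Lemma dependent_circuit I X : X \notin I -> exists2 C, circuit I C & C \subset X.
Proof.
move=> XnI; have [C /minsetP[CnI Cmin] sCX] := minset_exists (P := fun C => C \notin I) XnI.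
exists C => //; rewrite /circuit CnI /=; apply/forallP => D; apply/implyP => pDC.
by apply: contraT => /Cmin/(_ (proper_sub pDC)) eDC; rewrite eDC properxx in pDC.
Qed.

(** Let r be the rank. A dependent [X] with fewer than r elements contains a circuit [C] with rank
    below [#|C|], hence at most r - 2. It is nonspanning, yet too small in rank to be a
    hyperplane. *)
Lemma sparse_paving_small I X : is_matroid I -> sparse_paving I ->
  #|X| < rank I setT -> X \in I.
Proof.
move=> Im Isp ltX; apply: contraT => /dependent_circuit[C Cc sCX].
have leC := subset_leq_card sCX.
have I0 := matroid0 Im.
have rC : rank I C < #|C| by apply: rank_dep => //; case/andP: Cc.
have /forallP/(_ C)/implyP := Isp; rewrite Cc /=.
case/(_ _)/andP; first by lia.
by move=> _ /eqP; lia.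
Qed.

Lemma sparse_paving_in I X : is_matroid I -> sparse_paving I ->
  (X \in I) = (#|X| <= rank I setT) && (X \notin nonbases I).
Proof.
move=> Im Isp; rewrite inE negb_and negbK.
case: ltngtP => [/(sparse_paving_small Im Isp) -> //| lt |] //=.
by apply: contraTF lt => /card_le_rank; rewrite -leqNgt.
Qed.

(** Suppose nonbases [X] and [Y] differ by exchanging [x] for [y]. All smaller sets are independent,
    so [X] is a nonspanning circuit, hence a hyperplane, and [y |: X] is spanning. Augmenting
    [X :&: Y] from a basis of [y |: X] then makes [X] or [Y] independent. *)
Lemma nonbases_stable I : is_matroid I -> sparse_paving I ->
  stable (rank I setT) (nonbases I).
Proof.
move=> Im Isp X Y; rewrite !inE => /andP[/eqP cX XnI] /andP[/eqP cY YnI] neXY.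
have I0 := matroid0 Im.
have pIX : X :&: Y \proper X.
  rewrite properEneq subsetIl andbT; apply: contra neXY => /eqP/setIidPl sXY.
  by rewrite eqEcard sXY cX cY leqnn.
have ltI := proper_card pIX.
rewrite ltnNge; apply/negP => leI.
have cI : #|X :&: Y|.+1 = rank I setT by lia.
have [x Xd] : exists x, X :\: Y = [set x].
  by apply/cards1P; have := cardsID Y X; lia.
have [y Yd] : exists y, Y :\: X = [set y].
  by apply/cards1P; have := cardsID X Y; rewrite setIC; lia.
have defX : x |: (X :&: Y) = X by rewrite -Xd setUC setID.
have defY : y |: (X :&: Y) = Y by rewrite -Yd setUC setIC setID.
have Xc : circuit I X.
  rewrite /circuit XnI /=; apply/forallP => D; apply/implyP => /proper_card ltD.
  by apply: sparse_paving_small => //; rewrite -cX.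
have /forallP/(_ X)/implyP := Isp.
rewrite Xc -{1}cX rank_dep //= => /(_ isT)/andP[/forallP/(_ y)/implyP].
have -> : y \notin X.
  have : y \in Y :\: X by rewrite Yd set11.
  by rewrite inE => /andP[].
move=> /(_ isT) rX /eqP rX1.
have [B [BI sB cB]] := rank_witness (y |: X) I0.
have XYI : X :&: Y \in I by apply: sparse_paving_small => //; rewrite -cX.
have [|z] := matroid_aug Im XYI BI; first by rewrite cB -ltnS cI -rX1 ltnS.
rewrite inE => /andP[zXY /(subsetP sB)]; rewrite !inE => /predU1P[->|zX].
  by rewrite defY (negPf YnI).
have -> : z = x.
  by apply/set1P; rewrite -Xd inE zX andbT; apply: contra zXY => zY; rewrite inE zX.
by rewrite defX (negPf XnI).
Qed.

Lemma sparse_paving_inj I J : is_matroid I -> sparse_paving I ->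
  is_matroid J -> sparse_paving J -> rank I setT = rank J setT ->
  nonbases I = nonbases J -> I = J.
Proof.
move=> Im Isp Jm Jsp er enb; apply/setP => X.
by rewrite (sparse_paving_in X Im) // (sparse_paving_in X Jm) // er enb.
Qed.

(** * From stable families back to sparse paving matroids *)

Definition stable_matroid (r : nat) S : {set {set T}} :=
  [set X : {set T} | (#|X| <= r) && (X \notin S)].

Variables (r : nat) (S : {set {set T}}).
Hypotheses (Sst : stable r S) (Sr : {in S, forall X, #|X| = r}).
Hypotheses (r_gt0 : 0 < r) (r_lt : r < #|T|).

Lemma stable_swap X x y : x \notin X -> y \notin X -> x != y -> #|X|.+1 = r ->
  x |: X \in S -> y |: X \notin S.
Proof.
move=> xX yX xy cX xS; apply/negP => yS.
have ne : x |: X != y |: X.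
  apply: contraNneq xX => e; have : x \in y |: X by rewrite -e setU11.
  by rewrite !inE (negPf xy).
have := Sst xS yS ne; rewrite -cX ltnS ltnNge => /negP[].
by apply: subset_leq_card; rewrite subsetI !subsetUr.
Qed.

Lemma exists_subset_card X k : k <= #|X| -> exists2 Y : {set T}, Y \subset X & #|Y| = k.
Proof.
rewrite -bin_gt0 -cards_draws => /card_gt0P[Y].
by rewrite inE => /andP[sYX /eqP cY]; exists Y.
Qed.

Let I := stable_matroid r S.

Lemma stable_matroid_small X : #|X| < r -> X \in I.
Proof.
move=> lt; rewrite inE (ltnW lt) /=.
by apply/negP => /Sr cX; rewrite cX ltnn in lt.
Qed.

Lemma stable_matroid_is_matroid : is_matroid I.
Proof.
apply/and3P; split.
- by apply: stable_matroid_small; rewrite cards0.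
- apply/forallP => X; apply/forallP => Y; apply/implyP => /andP[YI sXY].
  have [leYX | ltXY] := leqP #|Y| #|X|.
    by have /eqP -> : X == Y by rewrite eqEcard sXY.
  by apply: stable_matroid_small; move: YI; rewrite inE => /andP[? _]; lia.
apply/forallP => X; apply/forallP => Y; apply/implyP => /andP[/andP[_]].
rewrite {1}inE => /andP[leY YS] ltXY; apply/existsP.
have /subsetPn[x xY xX] : ~~ (Y \subset X).
  by apply: contraL ltXY => /subset_leq_card; rewrite -leqNgt.
have [lt|ge] := ltnP #|X|.+1 r.
  by exists x; rewrite inE xX xY stable_matroid_small // cardsU1 xX.
have cX : #|X|.+1 = r by lia.
have card1 z : z \notin X -> #|z |: X| = r by move=> zX; rewrite cardsU1 zX.
have [xS|xS] := boolP (x |: X \in S); last first.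
  by exists x; rewrite !inE xX xY xS card1 ?leqnn.
have /subsetPn[y yY yxX] : ~~ (Y \subset x |: X).
  apply: contra YS => sY; suff /eqP -> : Y == x |: X by [].
  by rewrite eqEcard sY card1 //; lia.
move: yxX; rewrite !inE negb_or => /andP[yx yX].
exists y; rewrite !inE yX yY card1 // leqnn /=.
by apply: (stable_swap xX) => //; rewrite eq_sym.
Qed.

(** As [r < #|T|], an [(r - 1)]-set has two one-element extensions, and stability keeps one of them
    out of [S]. *)
Lemma stable_matroid_rank : rank I setT = r.
Proof.
apply/eqP; rewrite eqn_leq; apply/andP; split.
  by apply/bigmax_leqP => Y; rewrite inE => /andP[/andP[]].
have [|X _ cX] := @exists_subset_card setT r.-1; first by rewrite cardsT; lia.
have [|Z sZ cZ] := @exists_subset_card (~: X) 2; first by rewrite cardsCs setCK; lia.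
have /cards2P[x [y [xy defZ]]] : #|Z| == 2 by rewrite cZ.
have xX : x \notin X by rewrite -in_setC (subsetP sZ) // defZ !inE eqxx.
have yX : y \notin X by rewrite -in_setC (subsetP sZ) // defZ !inE eqxx orbT.
have c1 z : z \notin X -> #|z |: X| = r by move=> zX; rewrite cardsU1 zX cX; lia.
have [z zX zS] : exists2 z, z \notin X & z |: X \notin S.
  have [xS|] := boolP (x |: X \in S); last by exists x.
  by exists y => //; apply: (stable_swap xX) => //; lia.
by rewrite -(c1 z zX); apply: card_le_rank; rewrite inE c1 // leqnn.
Qed.

Lemma stable_matroid_sparse_paving : sparse_paving I.
Proof.
have I0 := matroid0 stable_matroid_is_matroid.
apply/forallP => C; apply/implyP; rewrite stable_matroid_rank.
case/andP => /andP[CnI /forallP Cmin] ltC.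
have CS : C \in S.
  apply: contraLR CnI => CS; rewrite negbK inE CS andbT leqNgt.
  (* A circuit with more than [r] elements would contain an independent [r]-set and so be
     spanning. *)
  apply/negP => lt; have [D sDC cD] := exists_subset_card (ltnW lt).
  have DI : D \in I.
    apply: (implyP (Cmin D)); rewrite properEneq sDC andbT.
    by apply: contraL lt => /eqP <-; rewrite cD ltnn.
  by have := rankS I sDC; rewrite (rank_indep DI) cD leqNgt ltC.
have cC := Sr CS.
have [c cinC] : exists c, c \in C by apply/card_gt0P; rewrite cC.
have cCc : #|C :\ c|.+1 = r by rewrite -cC (cardsD1 c C) cinC.
apply/andP; split; last first.
  rewrite stable_matroid_rank eqn_leq ltC /= -cCc ltnS.
  by rewrite -[X in X <= _](@rank_indep I) ?rankS ?subsetDl // stable_matroid_small ?cCc.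
apply/forallP => x; apply/implyP => xC; apply: (leq_trans ltC).
have xCc : x \notin C :\ c by rewrite inE (negPf xC) andbF.
(* Exchanging [c] for [x] in [C] gives a neighbour of a member of [S], hence a basis inside
   [x |: C]. *)
have BI : x |: (C :\ c) \in I.
  rewrite inE cardsU1 xCc add1n cCc leqnn /=.
  apply: (@stable_swap _ c) => //; first by rewrite setD11.
    by apply: contraNneq xC => <-.
  by rewrite setD1K.
have cB : #|x |: (C :\ c)| = r by rewrite cardsU1 xCc.
by rewrite -{1}cB -(rank_indep BI); apply/rankS/setUS/subsetDl.
Qed.

Lemma stable_matroidK X : #|X| = r -> (X \in S) = (X \notin I).
Proof. by move=> cX; rewrite inE cX leqnn negbK. Qed.

End SparsePaving.

(** * Recognizing the two six-element minors *)

Definition triangle_lines : seq {set 'I_6} :=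
  [:: [set ia; ib; ic]; [set ic; id6; ie]; [set ie; iF; ia]].

Lemma forall_I6 (P : 'I_6 -> Prop) :
  P ia -> P ib -> P ic -> P id6 -> P ie -> P iF -> forall i, P i.
Proof.
move=> Pa Pb Pc Pd Pe Pf i; rewrite -[i]inord_val.
by case: i => [[|[|[|[|[|[|m]]]]]] lt].
Qed.

Lemma sum_I6 (F : 'I_6 -> nat) :
  \sum_i F i = F ia + F ib + F ic + F id6 + F ie + F iF.
Proof.
rewrite !big_ord_recl big_ord0 addn0 !addnA.
by do !congr (_ + _); congr F; apply/val_inj; rewrite /ia /ib /ic /id6 /ie /iF [RHS]inordK.
Qed.

Lemma eq_inord n i j : i <= n -> j <= n -> (inord i == inord j :> 'I_n.+1) = (i == j).
Proof. by move=> lei lej; rewrite -val_eqE /= !inordK. Qed.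

Lemma card_I6 (A : {set 'I_6}) :
  #|A| = (ia \in A) + (ib \in A) + (ic \in A) + (id6 \in A) + (ie \in A) + (iF \in A).
Proof. rewrite -sum1_card big_mkcond sum_I6; reflexivity. Qed.

Lemma three_sets_I6 (Z : {set 'I_6}) : #|Z| = 3 ->
  [|| Z \in triangle_lines, Z == [set ib; id6; iF]
    | has (fun L => #|Z :&: L| == 2) triangle_lines].
Proof.
have setE (A : {set 'I_6}) :
    (Z == A) = all (fun i => (i \in Z) == (i \in A)) [:: ia; ib; ic; id6; ie; iF].
  apply/eqP/allP => [-> //|h]; apply/setP.
  by apply: forall_I6; apply/eqP/h; rewrite !inE eqxx ?orbT.
rewrite /triangle_lines /= in_cons in_cons mem_seq1 !setE !card_I6 /=.
rewrite !in_setU !in_setI !in_setU !in_set1 /ia /ib /ic /id6 /ie /iF !eq_inord //=.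
(* Everything is now a Boolean statement in the six membership bits of [Z], checked on all 64
   cases. *)
by do 6!case: (_ \in Z).
Qed.

Section Minor.
Variable T : finType.
Implicit Types (I : {set {set T}}) (u X : {set T}).

(** Contract [X] and delete everything outside [X] and the image of [f]. By [three_sets_I6] a 3-set
    is a line, or shares two points with a line and is independent by stability, or is [bdf], whose
    status decides between the two minors. *)
Lemma triangle_minor I (X : {set T}) (f : {ffun 'I_6 -> T}) :
  is_matroid I -> sparse_paving I -> injective f -> (forall i, f i \notin X) ->
  {in triangle_lines, forall L, (f @: (L : {set _})) :|: X \in nonbases I} ->
  has_minor_iso I whirl3 \/ has_minor_iso I MK4.
Proof.
move=> Im Isp f_inj fX Lnb; have I0 := matroid0 Im.
have disj (Z : {set 'I_6}) : [disjoint f @: Z & X].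
  by rewrite disjoint_subset; apply/subsetP => _ /imsetP[i _ ->]; rewrite inE.
have cardZ (Z : {set 'I_6}) : #|f @: Z :|: X| = #|Z| + #|X|.
  by rewrite cardsU disjoint_setI0 // cards0 subn0 card_imset.
have cX : #|X| + 3 = rank I setT.
  have: f @: [set ia; ib; ic] :|: X \in nonbases I by apply: Lnb; rewrite inE eqxx.
  rewrite inE cardZ => /andP[/eqP <- _]; rewrite addnC; congr (_ + _).
  by rewrite card_I6 !inE /ia /ib /ic /id6 /ie /iF !eq_inord.
have XI : X \in I by apply: sparse_paving_small => //; lia.
set D := ~: (f @: setT :|: X).
have minorE (Z : {set 'I_6}) : (f @: Z \in delete (contract I X) D) =
    (#|Z| <= 3) && (f @: Z :|: X \notin nonbases I).
  rewrite /delete /contract 2!in_set disj (rank_indep XI) card_imset // -cardZ.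
  rewrite rank_eq_card //= sparse_paving_in //.
  have -> : [disjoint f @: Z & D].
    by rewrite disjoints_subset setCK subsetU // imsetS ?subsetT.
  by rewrite andbT cardZ -cX addnC leq_add2l.
(* Adding [X] to the images of [Z] and [L] gives sets of full rank size that share all but one
   element. *)
have lineC (Z L : {set 'I_6}) : L \in triangle_lines -> #|Z| = 3 -> #|Z :&: L| = 2 ->
    f @: Z :|: X \notin nonbases I.
  move=> LT cZ cZL; apply/negP => ZS.
  have ne : f @: Z :|: X != f @: L :|: X.
    apply/eqP => e; have := cardZ Z; rewrite -[f @: Z :|: X]setIid {2}e -setUIl.
    rewrite -imsetI; last by move=> ? ? _ _; apply: f_inj.
    by rewrite cardZ cZL cZ => /addIn.
  have := nonbases_stable Im Isp ZS (Lnb _ LT) ne.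
  rewrite -setUIl -imsetI; last by move=> ? ? _ _; apply: f_inj.
  by rewrite cardZ cZL; lia.
have cD : f @: setT == ~: (X :|: D).
  apply/eqP/setP => t; rewrite !inE negb_or negbK.
  have [/imsetP[i _ ->]|] := boolP (t \in f @: setT); first by rewrite fX.
  by rewrite /= andNb.
have minor (N : {set {set 'I_6}}) :
    (forall Z : {set 'I_6}, (Z \in N) = (#|Z| <= 3) && (f @: Z :|: X \notin nonbases I)) ->
    has_minor_iso I N.
  move=> NE; apply/existsP; exists X; apply/existsP; exists D; apply/existsP; exists f.
  rewrite cD; apply/and4P; split=> //.
  - by rewrite disjoints_subset setCK subsetUr.
  - exact/injectiveP.
  by apply/forallP => Z; rewrite NE minorE.
have lt3 (Z : {set 'I_6}) : #|Z| < 3 -> f @: Z :|: X \notin nonbases I.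
  move=> lt; rewrite !inE negb_and negbK sparse_paving_small ?orbT //.
  by rewrite cardZ; lia.
have eq3 (Z : {set 'I_6}) : #|Z| = 3 -> (f @: Z :|: X \in nonbases I) =
    (Z \in triangle_lines) ||
    (Z == [set ib; id6; iF]) && (f @: [set ib; id6; iF] :|: X \in nonbases I).
  move=> cZ; have [/Lnb -> //|ZT] := boolP (Z \in triangle_lines).
  have [-> //|nbdf] := eqVneq Z [set ib; id6; iF].
  have := three_sets_I6 cZ; rewrite (negPf ZT) (negPf nbdf) 2!orFb.
  by case/hasP => L LT /eqP cZL; apply/negbTE/(lineC _ L).
have [bdf|bdf] := boolP (f @: [set ib; id6; iF] :|: X \in nonbases I); [right|left].
all: apply: minor => Z; rewrite inE.
all: have [lt|gt|e] /= := ltngtP #|Z| 3; rewrite ?orbF.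
(* The six goals are [#|Z|] below, above and equal to 3, for each of the two matroids; solved goals
   shift the later numbering. *)
1,4: by rewrite -ltnS lt lt3.
1,3: by apply/negbTE; rewrite -ltnNge; apply: leq_trans gt.
all: rewrite e /= eq3 // ?bdf ?(negPf bdf) ?andbF ?orbF ?andbT //.
by rewrite /triangle_lines !inE -!orbA.
Qed.


End Minor.

(** * Neighbours in the Johnson graph and double counting *)

Section Swaps.
Variable T : finType.
Implicit Types (I S : {set {set T}}) (u X : {set T}).

(** A pair is (entering element, leaving element), encoding a Johnson neighbour of [u] that lies in
    [S]. *)
Definition swaps (S : {set {set T}}) (u : {set T}) : {set T * T} :=
  [set p | [&& p.1 \notin u, p.2 \in u & p.1 |: (u :\ p.2) \in S]].

(** Two neighbours of [u] with a common entering or leaving element are themselves adjacent, which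
    stability forbids. *)
Lemma stable_swaps_inj r S u : stable r S -> #|u| = r ->
  {in swaps S u &, forall p q, p != q -> p.1 != q.1 /\ p.2 != q.2}.
Proof.
move=> Sst cu [x a] [y b]; rewrite !inE /= => /and3P[xu au xS] /and3P[yu bu yS].
rewrite xpair_eqE negb_and => ne.
have ne2 : a |: (u :\ a) = b |: (u :\ b) by rewrite !setD1K.
have cua : #|u :\ a|.+1 = r by rewrite -cu (cardsD1 a u) au.
have neX : x |: (u :\ a) != y |: (u :\ b).
  apply: contraTneq ne => e; rewrite negb_or !negbK.
  have xy : x = y.
    have : x \in y |: (u :\ b) by rewrite -e setU11.
    by rewrite !inE (negPf xu) andbF orbF => /eqP.
  rewrite xy eqxx /=; apply: contraT => ab.
  have : a \in x |: (u :\ a) by rewrite e !inE ab au orbT.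
  by rewrite !inE eqxx orbF => /eqP ax; rewrite -ax au in xu.
have lt := Sst _ _ xS yS neX.
split; apply: contraTneq lt => e; rewrite -leqNgt -cua ltnS; last first.
  by rewrite e; apply/subset_leq_card; rewrite subsetI !subsetUr.
(* With a common entering [x] and leaving [a], [b], both sets contain [u - a - b + x], of size
   [r - 1]. *)
rewrite -e; have -> : #|u :\ a| = #|x |: (u :\ a :\ b)|.
  rewrite cardsU1 !inE (negPf xu) !andbF add1n; apply/eqP.
  rewrite (cardsD1 b (u :\ a)) !inE bu andbT.
  by rewrite (_ : b != a) //; apply: contraNneq neX => ba; rewrite ba e.
apply/subset_leq_card; rewrite subsetI; apply/andP; split.
  by apply/setUS/subsetDl.
by apply/setUS/subsetP => z; rewrite !inE => /and3P[-> _ ->].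
Qed.

Lemma card_swaps_le2 I u : is_matroid I -> sparse_paving I ->
  ~~ has_minor_iso I whirl3 -> ~~ has_minor_iso I MK4 ->
  #|u| = rank I setT -> #|swaps (nonbases I) u| <= 2.
Proof.
move=> Im Isp noW noK cu; rewrite leqNgt; apply/negP.
have ne := stable_swaps_inj (nonbases_stable Im Isp) cu.
(* The names are chosen so that, with [X = u - {a, c, e}], the nonbases [u - e + b], [u - a + d],
   [u - c + f] are [X] together with [abc], [cde], [efa]. *)
case/card_gt2P => -[b e] [[d a] [[f c] [[P1 P2 P3]]]] [ne12 ne23 ne31].
have [/= bd ea] := ne _ _ P1 P2 ne12.
have [/= df ac] := ne _ _ P2 P3 ne23.
have [/= fb ce] := ne _ _ P3 P1 ne31.
move: P1 P2 P3; rewrite !inE /= => /and3P[bu eu P1] /and3P[du au P2] /and3P[fu cu' P3].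
pose s := [:: a; b; c; d; e; f].
have ne_u x y : x \in u -> y \notin u -> (x == y = false) * (y == x = false).
  move=> xu yu; suff xy : x == y = false by rewrite (eq_sym y) xy.
  by apply: contraNF yu => /eqP <-.
have us : uniq s.
  rewrite /= !inE (ne_u a b) // (ne_u a d) // (ne_u a f) // (ne_u c b) // (ne_u c d) //.
  rewrite (ne_u c f) // (ne_u e b) // (ne_u e d) // (ne_u e f) //.
  by rewrite (eq_sym a e) (eq_sym b f) (negPf ac) (negPf ea) (negPf bd) (negPf fb)
    (negPf ce) (negPf df).
pose g := [ffun i : 'I_6 => nth a s i].
have gE : (g ia = a) * (g ib = b) * (g ic = c) * (g id6 = d) * (g ie = e) * (g iF = f).
  by rewrite !ffunE /ia /ib /ic /id6 /ie /iF !inordK.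
pose X := u :\: [set a; c; e].
have sub : [set a; c; e] \subset u by rewrite !subUset !sub1set au eu cu'.
have [] := @triangle_minor _ I X g Im Isp; last first.
- by rewrite (negPf noK).
- by rewrite (negPf noW).
- have imE i j k : g @: [set i; j; k] = [set g i; g j; g k].
    by rewrite !imsetU !imset_set1.
  move=> L; rewrite !inE => /or3P[]/eqP->; rewrite imE !gE.
  - rewrite (_ : _ :|: X = b |: (u :\ e)) //; apply/setP => z; rewrite !inE.
    have [->|_] := eqVneq z a; first by rewrite au (eq_sym a e) ea orbT.
    have [->|_] := eqVneq z c; first by rewrite cu' ce !orbT.
    by case: (z == b); case: (z == e).
  - rewrite (_ : _ :|: X = d |: (u :\ a)) //; apply/setP => z; rewrite !inE.
    have [->|_] := eqVneq z e; first by rewrite eu ea !orbT.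
    have [->|_] := eqVneq z c; first by rewrite cu' (eq_sym c a) ac !orbT.
    by case: (z == a); case: (z == d).
  rewrite (_ : _ :|: X = f |: (u :\ c)) //; apply/setP => z; rewrite !inE.
  have [->|_] := eqVneq z e; first by rewrite eu (eq_sym e c) ce !orbT.
  have [->|_] := eqVneq z a; first by rewrite au ac !orbT.
  by case: (z == c); case: (z == f).
- apply: forall_I6; rewrite gE !inE ?eqxx ?orbT // negb_and ?bu ?du ?fu orbT //.
by move=> i j; rewrite !ffunE => /eqP; rewrite nth_uniq // => /eqP/val_inj.
Qed.


(** Each [X] in [S] has [r * (#|T| - r)] Johnson neighbours [u], and is in turn reached from each by
    the reverse swap. *)
Lemma card_swaps_sum S r : {in S, forall X, #|X| = r} ->
  #|S| * (r * (#|T| - r)) <= \sum_(u : {set T} | #|u| == r) #|swaps S u|.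
Proof.
move=> Sr.
have -> : #|S| * (r * (#|T| - r)) = \sum_(X in S) #|setX X (~: X)|.
  rewrite -sum_nat_const; apply: eq_bigr => X XS.
  by rewrite cardsX [#|~: X|]cardsCs setCK (Sr X XS).
pose P (X : {set T}) (p : T * T) := (p.1 \in X) && (p.2 \notin X).
rewrite (eq_bigr (fun X => \sum_p P X p)); last first.
  move=> X _; rewrite -sum1_card big_mkcond; apply: eq_bigr => p _.
  by rewrite !inE.
rewrite [leqRHS](eq_bigr (fun u => \sum_p (p \in swaps S u))); last first.
  by move=> u _; rewrite -sum1_card big_mkcond.
rewrite exchange_big [leqRHS]exchange_big /=; apply: leq_sum => -[x y] _.
have sumb (A Q : pred {set T}) :
    \sum_(X | A X) (Q X : nat) = #|[set X | A X && Q X]|.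
  rewrite -sum1_card [RHS](eq_bigl (fun X => A X && Q X)) => [|X]; last by rewrite inE.
  by rewrite big_mkcondr.
rewrite !sumb; set L := [set X | _ && _].
(* For a fixed pair [(x, y)], this map sends [X] to the [u] whose swap [(x, y)] restores [X], so it
   is injective. *)
pose h (X : {set T}) := y |: (X :\ x).
have hK : {in L, forall X, x |: (h X :\ y) = X}.
  move=> X; rewrite !inE /= => /and3P[_ xX yX].
  by rewrite setU1K ?setD1K // !inE (negPf yX) andbF.
have hI : {in L &, injective h}.
  by move=> X Y XL YL e; rewrite -(hK X XL) -(hK Y YL) e.
rewrite -(card_in_imset hI); apply/subset_leq_card/subsetP => _ /imsetP[X XL ->].
have hX := hK X XL; move: XL; rewrite !inE /= hX => /and3P[XS xX yX].
rewrite XS /h cardsU1 !inE (negPf yX) !eqxx andbF /= !andbT.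
have := cardsD1 x X; rewrite xX (Sr X XS) => ->; rewrite eqxx /=.
by rewrite orbF; apply: contraNneq yX => <-.
Qed.

End Swaps.

(** * Numerical estimates for the number of small families *)

(** With N the size of [V], this is the sum of ['C(N, i)] over [i <= j] being at most
    [D ^ j * (1 + 1/D) ^ N], denominators cleared: in the binomial expansion the terms with [i <= j]
    carry weight at least [D ^ - j]. *)
Lemma card_small_subsets (U : finType) (V : {set U}) j D : 0 < D ->
  D ^ #|V| * #|[set S : {set U} | (S \subset V) && (#|S| <= j)]| <= D ^ j * D.+1 ^ #|V|.
Proof.
move=> D0; set N := #|V|; set F := [set S | _].
have -> : #|F| = \sum_(i < N.+1 | i <= j) 'C(N, i).
  pose k (S : {set U}) : 'I_N.+1 := inord #|S|.
  have kE S : S \in F -> k S = #|S| :> nat.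
    by rewrite inE => /andP[/subset_leq_card le _]; rewrite inordK.
  rewrite -sum1_card (partition_big k (fun i => i <= j)) /=; last first.
    by move=> S SF; rewrite kE //; move: SF; rewrite inE => /andP[].
  apply: eq_bigr => i ij; rewrite -cards_draws -sum1_card; apply: eq_bigl => S.
  rewrite [RHS]inE; apply/andP/andP => [[SF /eqP <-]|[sSV /eqP cS]].
    by rewrite kE //; move: SF; rewrite inE => /andP[].
  have SF : S \in F by rewrite inE sSV cS.
  by split=> //; apply/eqP/val_inj; rewrite /= kE.
rewrite -(addn1 D) expnDn !big_distrr /= [leqRHS](bigID (fun i : 'I_N.+1 => i <= j)) /=.
apply: leq_trans (leq_addr _ _); apply: leq_sum => i ij.
rewrite exp1n muln1 (mulnC 'C(N, i)) mulnA leq_mul2r -expnD leq_pexp2l ?orbT //.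
by have := ltn_ord i; lia.
Qed.

(** Bernoulli's inequality for [(1 - 1/(2h+1)) ^ i], whose lower bound [1 - i/(2h+1)] exceeds one
    half when [i <= h]. *)
Lemma half_expn_succ h i : i <= h -> (2 * h).+1 ^ i <= 2 * (2 * h) ^ i.
Proof.
move=> ih; suff bernoulli k : k <= h ->
    (2 * h).+1 ^ k * ((2 * h).+1 - k) <= (2 * h) ^ k * (2 * h).+1.
  have := bernoulli i ih; have : h.+1 <= (2 * h).+1 - i by lia.
  move=> le1 le2; rewrite -(@leq_pmul2r h.+1) //.
  apply: leq_trans (leq_trans (leq_mul (leqnn _) le1) le2) _.
  by rewrite mulnC [leqRHS]mulnAC leq_mul2r; apply/orP; right; lia.
elim: k => [|k IHk] kh; first by rewrite !expn0 subn0.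
have := IHk (ltnW kh); rewrite !expnS.
move: ((2 * h).+1 ^ k) ((2 * h) ^ k) => P Q le.
have [t et] : exists t, 2 * h = k + t by exists (2 * h - k); lia.
move: le; rewrite et subSS -addnS !addKn addnS => le.
apply: (@leq_trans ((k + t) * (P * t.+1))); last by rewrite -mulnA leq_mul2l le orbT.
by nia.
Qed.


Lemma leq_exp2rW a b k : a <= b -> a ^ k <= b ^ k.
Proof. by case: k => // k; rewrite leq_exp2r. Qed.

(** Cut the exponent into [N %/ h] blocks of length [h] and a remainder; each piece costs a factor
    2. *)
Lemma expn_succ_le h N : 0 < h -> (2 * h).+1 ^ N <= 2 ^ (N %/ h).+1 * (2 * h) ^ N.
Proof.
move=> h0; set q := N %/ h.
have le_q : (2 * h).+1 ^ (q * h) <= 2 ^ q * (2 * h) ^ (q * h).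
  by rewrite (mulnC q h) !expnM -expnMn; apply/leq_exp2rW/half_expn_succ.
have le_r : (2 * h).+1 ^ (N %% h) <= 2 * (2 * h) ^ (N %% h).
  by apply/half_expn_succ/ltnW; rewrite ltn_pmod.
have eN := divn_eq N h; rewrite -/q in eN.
rewrite [in leqLHS]eN [X in _ * _ ^ X]eN !expnD expnS.
by apply: leq_trans (leq_mul le_q le_r) _; rewrite mulnACA (mulnC _ 2).
Qed.

(** The two previous bounds with [D = 2 ^ p.+1] and [h = 2 ^ p]; a larger [p] shrinks the second
    term at the expense of the first. *)
Lemma card_small_subsets_pow2 (U : finType) (V : {set U}) j p :
  #|[set S : {set U} | (S \subset V) && (#|S| <= j)]| <= 2 ^ (p.+1 * j + #|V| %/ 2 ^ p + 1).
Proof.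
have D0 : 0 < 2 * 2 ^ p by rewrite muln_gt0 expn_gt0.
have h0 : 0 < 2 ^ p by rewrite expn_gt0.
have := card_small_subsets V j D0; have := expn_succ_le #|V| h0.
set F := #|[set S | _]|; set N := #|V| => le1 le2.
rewrite -(@leq_pmul2l ((2 * 2 ^ p) ^ N)) ?expn_gt0 ?D0 //.
apply: leq_trans le2 (leq_trans (leq_mul (leqnn _) le1) _).
by rewrite mulnA mulnC leq_mul2l -expnS -!expnM -expnD addn1 addnS leqnn orbT.
Qed.

(** With [a] half of [n %/ m], the right side is at least [(2 ^ a) ^ 2 >= a.+1 ^ 2], which is
    quadratic in [n]. *)
Lemma linear_le_expn c m n : 0 < m -> 8 * c * m * m + 8 * m <= n -> c * n <= 2 ^ (n %/ m).
Proof.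
move=> m0 le; set k := n %/ m; set a := k %/ 2.
have nk : n < m * k.+1 by rewrite mulnC ltn_ceil.
have ka : k < 2 * a.+1 by rewrite mulnC ltn_ceil.
have ka' : 2 * a <= k by rewrite mulnC leq_divM.
have cm : 8 * c * m < k + 1.
  by rewrite -(@ltn_pmul2l m) // addn1; nia.
apply: leq_trans (leq_pexp2l _ ka') => //.
rewrite mul2n -addnn expnD.
apply: (@leq_trans (a.+1 * a.+1)); last by apply: leq_mul; apply: ltn_expl.
apply: (@leq_trans (c * (m * (2 * a.+1)))); first by rewrite leq_mul2l; apply/orP; right; nia.
by nia.
Qed.

(** * The lower bound on the number of sparse paving matroids *)

Definition maxbin n := \max_(r < n.+1) 'C(n, r).

Lemma leq_maxbin n r : 'C(n, r) <= maxbin n.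
Proof.
have [lt|le] := ltnP n r; first by rewrite bin_small.
exact: (@leq_bigmax _ (fun i : 'I_n.+1 => 'C(n, i)) (Ordinal (le : r < n.+1))).
Qed.

Definition residue_class n r (c : 'I_n) : {set {set 'I_n}} :=
  [set X : {set 'I_n} | (#|X| == r) && ((\sum_(i in X) i) %% n == c)].

(** Adjacent sets differ by exchanging [x] for [y], so equal sums modulo [n] force [x] and [y] to be
    congruent; both are below [n], hence equal. *)
Lemma residue_class_stable n r (c : 'I_n) : stable r (residue_class r c).
Proof.
move=> X Y; rewrite !inE => /andP[/eqP cX /eqP sX] /andP[/eqP cY /eqP sY] neXY.
rewrite ltnNge; apply: contra neXY => leI.
have sIX := subset_leq_card (subsetIl X Y).
have [eI|eI] : #|X :&: Y| = r \/ #|X :&: Y|.+1 = r by lia.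
  have /eqP eX : X :&: Y == X by rewrite eqEcard subsetIl cX eI leqnn.
  have /eqP eY : X :&: Y == Y by rewrite eqEcard subsetIr cY eI leqnn.
  by rewrite -{1}eX eY.
have [x Xd] : exists x, X :\: Y = [set x].
  by apply/cards1P; have := cardsID Y X; lia.
have [y Yd] : exists y, Y :\: X = [set y].
  by apply/cards1P; have := cardsID X Y; rewrite setIC; lia.
suff exy : x = y by rewrite -(setID X Y) Xd exy -Yd setIC setID.
move: sX sY; rewrite (big_setID Y) /= Xd [in X in _ -> X](big_setID X) /= Yd !big_set1 setIC.
set s := \sum_(i in _) _ => <- /esym/eqP; rewrite eqn_modDl.
by rewrite !modn_small // => /eqP/val_inj.
Qed.

Lemma large_residue_class n r : 0 < n ->
  exists c : 'I_n, 'C(n, r) <= #|residue_class r c| * n.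
Proof.
case: n => // n _.
have [c _ maxc] := arg_maxnP (fun c : 'I_n.+1 => #|residue_class r c|)
  (isT : xpredT (ord0 : 'I_n.+1)).
exists c; have -> : 'C(n.+1, r) = \sum_(k : 'I_n.+1) #|residue_class r k|.
  rewrite -[in LHS](card_ord n.+1) -card_draws -sum1_card.
  rewrite (partition_big (fun X : {set 'I_n.+1} =>
    inord ((\sum_(i in X) i) %% n.+1) : 'I_n.+1) predT) //=.
  apply: eq_bigr => k _; rewrite -sum1_card; apply: eq_bigl => X; rewrite !inE.
  by rewrite -val_eqE /= inordK // ltn_pmod.
by rewrite -[X in _ * X]card_ord mulnC -sum_nat_const; apply: leq_sum => k _; apply: maxc.
Qed.

Lemma sp_count_ge n r (c : 'I_n) : 0 < r < n ->
  2 ^ #|residue_class r c| <= sp_count n.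
Proof.
case/andP=> r0 rn; have rT : r < #|'I_n| by rewrite card_ord.
have ok (S : {set {set 'I_n}}) : S \in powerset (residue_class r c) ->
    stable r S /\ {in S, forall X : {set 'I_n}, #|X| = r}.
  rewrite inE => /subsetP sub; split=> [X Y XS YS|X /sub]; last by rewrite inE => /andP[/eqP].
  by apply: residue_class_stable (sub _ XS) (sub _ YS).
rewrite -card_powerset -(@card_in_imset _ _ (stable_matroid r)).
  apply/subset_leq_card/subsetP => _ /imsetP[S /ok[Sst Sr] ->]; rewrite inE.
  by rewrite stable_matroid_is_matroid //= stable_matroid_sparse_paving.
move=> S S' /ok[_ Sr] /ok[_ Sr'] e; apply/setP => X.
have [cX|cX] := eqVneq #|X| r.
  by rewrite (stable_matroidK S cX) e -stable_matroidK.
by apply/idP/idP => [/Sr|/Sr'] /eqP; rewrite (negPf cX).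
Qed.

Lemma sp_count_lower n : 1 < n -> exists2 q, maxbin n <= q * n & 2 ^ q <= sp_count n.
Proof.
move=> n1; have [|r er] := @bigop.eq_bigmax _ (fun r : 'I_n.+1 => 'C(n, r)).
  by rewrite card_ord.
(* The extreme ranks have coefficient 1, less than ['C(n, 1) = n]. *)
have rint : 0 < r < n.
  have := leq_maxbin n 1; rewrite bin1 /maxbin er => le.
  have lern : r <= n by rewrite -ltnS.
  rewrite lt0n ltn_neqAle lern andbT.
  by apply/andP; split; apply: contraTneq le => ->; rewrite ?bin0 ?binn -ltnNge.
have [c le] := large_residue_class r (ltnW n1).
by exists #|residue_class r c|; [rewrite /maxbin er | apply: sp_count_ge].
Qed.


(* Since ['C(n, r) (n+1) (n+2) = 'C(n+2, r+1) (r+1) (n-r+1)], this is just Pascal's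
   rule applied twice; it handles all ranks [r] at once. *)
Lemma bin_le_maxbin n r : r <= n ->
  'C(n, r) * (n.+1 * n.+2) <= 4 * maxbin n * (r.+1 * (n - r).+1).
Proof.
move=> rn.
have e1 := mul_bin_down n.+1 r; have e2 := mul_bin_diag n.+2 r.
have le4 : 'C(n.+2, r.+1) <= 4 * maxbin n.
  case: r {rn e1 e2} => [|r]; rewrite !binS.
    by rewrite ?bin0; have := leq_maxbin n 1; have := leq_maxbin n 0; rewrite bin0; lia.
  by have := leq_maxbin n r; have := leq_maxbin n r.+1; have := leq_maxbin n r.+2; lia.
move: e1 e2; rewrite /= subSn // => e1 e2.
apply: leq_trans (leq_mul le4 (leqnn _)); apply/eq_leq.
by rewrite mulnA (mulnC 'C(n, r)) e1 -mulnA (mulnC 'C(n.+1, r)) e2; lia.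
Qed.


(** * The upper bound for matroids without the two minors *)

Lemma spX_nonbases_card n (I : {set {set 'I_n}}) : 1 < n ->
  is_matroid I -> sparse_paving I ->
  ~~ has_minor_iso I whirl3 -> ~~ has_minor_iso I MK4 ->
  #|nonbases I| * (n * n) <= 32 * maxbin n.
Proof.
move=> n1 Im Isp noW noK; set r := rank I setT.
have rn : r <= n by rewrite -[n in _ <= n]card_ord -cardsT rank_le_card.
have nbr : {in nonbases I, forall X : {set 'I_n}, #|X| = r}.
  by move=> X; rewrite inE => /andP[/eqP].
have nbC : #|nonbases I| <= 'C(n, r).
  rewrite -[n in 'C(n, _)]card_ord -card_draws; apply/subset_leq_card/subsetP => X.
  by rewrite !inE => /andP[].
(* In rank 0 or [n] there is at most one nonbasis, and [maxbin n >= 'C(n, 2)] suffices. *)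
have [rint|rext] := boolP (0 < r < n); last first.
  have C1 : 'C(n, r) = 1.
    have [->|->] : r = 0 \/ r = n by lia.
      by rewrite bin0.
    by rewrite binn.
  have := leq_maxbin n 2; have := mul_bin_diag n 1; rewrite bin1 => e.
  by rewrite C1 in nbC; nia.
have le2 : #|nonbases I| * (r * (n - r)) <= 2 * 'C(n, r).
  have := card_swaps_sum nbr; rewrite card_ord => /leq_trans; apply.
  apply: leq_trans (_ : \sum_(u : {set 'I_n} | #|u| == r) 2 <= _).
    by apply: leq_sum => u /eqP cu; apply: card_swaps_le2.
  by rewrite sum_nat_const -[n in 'C(n, _)]card_ord -card_draws cardsE mulnC.
have := bin_le_maxbin rn; set M := maxbin n; set C := 'C(n, r) in le2 *.
move: #|_| le2 => s le2 leM.
rewrite -(@leq_pmul2r (r.+1 * (n - r).+1)) //.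
(* Each factor at most doubles. The constant 32 is this 4, times the 2 of [le2], times the 4 of
   [bin_le_maxbin]. *)
have : r.+1 * (n - r).+1 <= 4 * (r * (n - r)) by nia.
move: (r.+1 * _) (r * _) le2 leM => d' d le2 leM led.
apply: (@leq_trans (s * (n.+1 * n.+2) * (4 * d))); first by apply: leq_mul => //; nia.
apply: (@leq_trans (8 * (C * (n.+1 * n.+2)))); first by nia.
by nia.
Qed.

(** The factor [n.+1] pays for the rank; in a fixed rank the matroid is determined by its nonbases,
    a small family of [r]-sets. *)
Lemma spX_count_upper n p : 1 < n ->
  spX_count n <= n.+1 * 2 ^ (p.+1 * ((32 * maxbin n) %/ (n * n)) + maxbin n %/ 2 ^ p + 1).
Proof.
move=> n1; set j := _ %/ (n * n).
pose k (I : {set {set 'I_n}}) : 'I_n.+1 := inord (rank I setT).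
have kE I : k I = rank I setT :> nat.
  by rewrite inordK // ltnS -[n in _ <= n]card_ord -cardsT rank_le_card.
rewrite /spX_count -sum1_card (partition_big k predT) //=.
rewrite -[X in _ <= X * _]card_ord -sum_nat_const; apply: leq_sum => r _.
rewrite sum1_card -[X in X <= _]cardsE; set F := [set I | _].
have FP I : I \in F -> [/\ is_matroid I, sparse_paving I,
    ~~ has_minor_iso I whirl3, ~~ has_minor_iso I MK4 & rank I setT = r].
  rewrite inE => /andP[]; rewrite inE => /and4P[? ? ? ?] /eqP er; split=> //.
  by rewrite -er kE.
rewrite -(@card_in_imset _ _ (@nonbases _)); last first.
  move=> I J /FP[? ? _ _ rI] /FP[? ? _ _ rJ]; apply: sparse_paving_inj => //.
  by rewrite rI rJ.
pose V := [set X : {set 'I_n} | #|X| == r].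
have cV : #|V| = 'C(n, r) by rewrite card_draws card_ord.
apply: leq_trans (_ : 2 ^ (p.+1 * j + #|V| %/ 2 ^ p + 1) <= _); last first.
  by rewrite leq_pexp2l // leq_add2r leq_add2l leq_div2r // cV leq_maxbin.
apply: leq_trans (card_small_subsets_pow2 V j p).
apply/subset_leq_card/subsetP => _ /imsetP[I /FP[Im Isp noW noK rI] ->].
rewrite inE; apply/andP; split.
  by apply/subsetP => X; rewrite !inE rI => /andP[].
rewrite /j leq_divRL; last by rewrite muln_gt0; lia.
exact: (spX_nonbases_card n1 Im Isp noW noK).
Qed.

(** * Comparison of the two bounds *)

Local Open Scope ring_scope.

(* s_X(n) = o(s(n)): for every e > 0, eventually s_X(n) <= e * s(n). *)
Theorem theorem7 :
  forall e : rat, 0 < e ->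
  exists N : nat, forall n : nat, (N <= n)%N ->
    (spX_count n)%:R <= e * (sp_count n)%:R.
Proof.
move=> e e0; pose K := (Num.bound e^-1).+1.
have eK : 1 <= e * K%:R.
  rewrite -(@ler_pM2l _ e^-1) ?invr_gt0 // mulr1 mulKf ?gt_eqF //.
  apply/ltW; apply: (lt_trans (archi_boundP _)); first by rewrite invr_ge0 ltW.
  by rewrite ltr_nat.
have K0 : (0 < K)%N by [].
move: K K0 eK => K K0 eK.
suff [N HN] : exists N, forall n, (N <= n -> K * spX_count n <= sp_count n)%N.
  exists N => n /HN; rewrite -(ler_nat rat) natrM => le.
  apply: le_trans (_ : e * (K%:R * (spX_count n)%:R) <= _); last by rewrite ler_pM2l.
  by rewrite mulrA ler_peMl.
(* The threshold of [linear_le_expn] with [c = 16 * K] and [m = 128], giving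
   [16 * K * n <= 2 ^ (n %/ 128)]. *)
exists (8 * (16 * K) * 128 * 128 + 8 * 128)%N => n nN.
have n1 : (1 < n)%N by lia.
have [q leq_q sp_ge] := sp_count_lower n1.
(* As [p.+1] is at most [n / 128] and [j] at most [32 * M / n ^ 2], the term [p.+1 * j] is at most
   [M / (4 * n)]; also [2 ^ p >= 4 * n], so [h] obeys the same bound. *)
set p := (n %/ 128 - 1)%N.
have linK := linear_le_expn (isT : (0 < 128)%N) nN.
have leM := leq_maxbin n 2.
have upp := spX_count_upper p n1.
apply: leq_trans sp_ge; apply: leq_trans (leq_mul (leqnn K) upp) _.
set j := (_ %/ (n * n))%N; set h := (_ %/ 2 ^ p)%N.
move: (maxbin n) leM leq_q @j @h upp => M leM leq_q j h _.
have p1 : (p.+1 = n %/ 128)%N by rewrite /p; lia.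
have e2 : (n * n.-1 = 2 * 'C(n, 2))%N by rewrite -mul_bin_diag bin1.
have lej : (p.+1 * j * (4 * n) <= M)%N.
  have := leq_divM (32 * M) (n * n); rewrite -/j => lej.
  have lep : (p.+1 * 128 <= n)%N by rewrite p1 leq_divM.
  rewrite -(@leq_pmul2r (32 * n)); last by lia.
  by have := leq_mul lep lej; congr (_ <= _)%N; lia.
have leh : (h * (4 * n) <= M)%N.
  apply: leq_trans (leq_divM M (2 ^ p)); rewrite leq_mul2l; apply/orP; right.
  rewrite -(@leq_pmul2l 2) // -expnS p1; apply: leq_trans linK.
  by rewrite mulnA leq_mul2r; apply/orP; right; lia.
(* Multiplied by [4 * n], the summands are at most [M], [M] and [n * n.-1 <= 2 * M], in total
   [4 * M <= 4 * q * n]. The slack [n.-1 %/ 4] absorbs the remaining factor [2 * K * n.+1]. *)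
have leq_t : (p.+1 * j + h + n.-1 %/ 4 <= q)%N.
  rewrite -(@leq_pmul2r (4 * n)); last by lia.
  have let4 := leq_divM n.-1 4.
  have le4 : (n.-1 %/ 4 * (4 * n) <= n * n.-1)%N.
    by rewrite mulnA [leqRHS]mulnC leq_mul2r let4 orbT.
  move: (n * n.-1)%N (n.-1 %/ 4)%N (p.+1 * j)%N e2 le4 lej leh => x t y; rewrite !mulnDl.
  rewrite (mulnCA q 4); lia.
have : (2 ^ (n %/ 128) <= 2 ^ (n.-1 %/ 4))%N.
  by rewrite leq_pexp2l //; lia.
move=> le24; apply: leq_trans (_ : 2 ^ (p.+1 * j + h + n.-1 %/ 4) <= _)%N;
  last by rewrite leq_pexp2l.
move: (p.+1 * j + h)%N => s; rewrite !expnD expn1.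
apply: (@leq_trans (2 ^ s * (16 * K * n))).
  rewrite [leqLHS](_ : _ = 2 ^ s * (K * (n.+1 * 2)))%N; last first.
    by rewrite (mulnCA n.+1) (mulnCA K).
  by rewrite leq_mul2l (mulnC 16) -mulnA leq_mul2l; apply/orP; right; apply/orP; right; lia.
by rewrite leq_mul2l (leq_trans linK le24) orbT.
Qed.
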